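(* Let $Q_{w,n}$ be the Horadam quaternions with real parameters $a,b,p,q$. The Binet formula of the Horadam quaternions is $$Q_{w,n}=\frac{1}{\alpha-\beta}\left(A\,\underline{\alpha}\,\alpha^n-B\,\underline{\beta}\,\beta^n\right)=bT_n+aqT_{n-1},$$ where $A=b-a\beta$, $B=b-a\alpha$, and $$T_n=\frac{1}{\sqrt{p^2+4q}}\left\{\left(\frac{p+\sqrt{p^2+4q}}{2}\right)^n-\left(\frac{p-\sqrt{p^2+4q}}{2}\right)^n\right\}.$$
   Context: The Horadam sequence $W_n=W_n(a,b;p,q)$ is defined by $W_0=a$, $W_1=b$ and $W_n=pW_{n-1}+qW_{n-2}$ for $n\ge 2$. For integers $n\ge 0$ the Horadam quaternion is $Q_{w,n}=W_n+W_{n+1}i+W_{n+2}j+W_{n+3}k$, where $i,j,k$ are the Hamilton units with $i^2=j^2=k^2=ijk=-1$; these satisfy $Q_{w,n+2}=pQ_{w,n+1}+qQ_{w,n}$. The numbers $\alpha=\frac{p+\sqrt{p^2+4q}}{2}$ and $\beta=\frac{p-\sqrt{p^2+4q}}{2}$ are the roots of $x^2-px-q=0$, and $\underline{\alpha}=1+i\alpha+j\alpha^2+k\alpha^3$, $\underline{\beta}=1+i\beta+j\beta^2+k\beta^3$.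
   Formalization: The last expression is a scalar as printed, so that equality fails (a=0, b=p=q=1, n=0); there T_n is replaced by T_n+T_{n+1}i+T_{n+2}j+T_{n+3}k. We assume p^2+4q nonzero, and for the last equality n≥1 or q nonzero, so that T_{n-1} is defined. Scalars may be complex. *)

(* Defs.v *)
From HB Require Import structures.
From mathcomp Require Import all_boot all_order all_algebra.
From mathcomp Require Import ring reals complex.

Set Implicit Arguments.
Unset Strict Implicit.
Unset Printing Implicit Defensive.

Import Order.TTheory GRing.Theory Num.Theory.
Local Open Scope ring_scope.
Local Open Scope complex_scope.

(* Hamilton quaternions with coefficients in a commutative ring K: [quat R] is
   the usual skew field when R is the reals, and [quat R[i]] is the algebra of
   complexified quaternions, in which the imaginary unit of R[i] is a central
   scalar, unrelated to the Hamilton unit [qi]. *)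
Record quat (K : Type) := Quat { q0 : K; q1 : K; q2 : K; q3 : K }.

Section QuatType.
Variable K : Type.
Definition quat_to (x : quat K) : K * K * K * K := (q0 x, q1 x, q2 x, q3 x).
Definition quat_of (t : K * K * K * K) : quat K :=
  let: (a, b, c, d) := t in Quat a b c d.
Lemma quat_toK : cancel quat_to quat_of. Proof. by case. Qed.
End QuatType.

HB.instance Definition _ (K : eqType) :=
  Equality.copy (quat K) (can_type (@quat_toK K)).
HB.instance Definition _ (K : choiceType) :=
  Choice.copy (quat K) (can_type (@quat_toK K)).

Section QuatAlgebra.
Variable K : comNzRingType.
Implicit Types x y z : quat K.

Definition addq x y :=
  Quat (q0 x + q0 y) (q1 x + q1 y) (q2 x + q2 y) (q3 x + q3 y).
Definition oppq x := Quat (- q0 x) (- q1 x) (- q2 x) (- q3 x).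

Fact addqA : associative addq.
Proof. by move=> x y z; rewrite /addq /= !addrA. Qed.
Fact addqC : commutative addq.
Proof. by move=> x y; congr Quat; exact: addrC. Qed.
Fact add0q : left_id (Quat 0 0 0 0) addq.
Proof. by case=> *; rewrite /addq /= !add0r. Qed.
Fact addNq : left_inverse (Quat 0 0 0 0) oppq addq.
Proof. by case=> *; rewrite /addq /= !addNr. Qed.

HB.instance Definition _ :=
  GRing.isZmodule.Build (quat K) addqA addqC add0q addNq.

Definition mulq x y :=
  Quat (q0 x * q0 y - q1 x * q1 y - q2 x * q2 y - q3 x * q3 y)
       (q0 x * q1 y + q1 x * q0 y + q2 x * q3 y - q3 x * q2 y)
       (q0 x * q2 y - q1 x * q3 y + q2 x * q0 y + q3 x * q1 y)
       (q0 x * q3 y + q1 x * q2 y - q2 x * q1 y + q3 x * q0 y).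

Fact mulqA : associative mulq.
Proof. by move=> x y z; rewrite /mulq /=; congr Quat; ring. Qed.
Fact mul1q : left_id (Quat 1 0 0 0) mulq.
Proof. by case=> *; rewrite /mulq /=; congr Quat; ring. Qed.
Fact mulq1 : right_id (Quat 1 0 0 0) mulq.
Proof. by case=> *; rewrite /mulq /=; congr Quat; ring. Qed.
Fact mulqDl : left_distributive mulq addq.
Proof. by move=> x y z; rewrite /mulq /addq /=; congr Quat; ring. Qed.
Fact mulqDr : right_distributive mulq addq.
Proof. by move=> x y z; rewrite /mulq /addq /=; congr Quat; ring. Qed.
Fact oneq_neq0 : Quat 1 0 0 0 != 0 :> quat K.
Proof. by apply/eqP=> -[/eqP]; rewrite oner_eq0. Qed.

HB.instance Definition _ := GRing.Zmodule_isNzRing.Build (quat K)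
  mulqA mul1q mulq1 mulqDl mulqDr oneq_neq0.

Definition scaleq (c : K) x := Quat (c * q0 x) (c * q1 x) (c * q2 x) (c * q3 x).

Fact scaleqA c d x : scaleq c (scaleq d x) = scaleq (c * d) x.
Proof. by rewrite /scaleq /= !mulrA. Qed.
Fact scale1q : left_id 1 scaleq.
Proof. by case=> *; rewrite /scaleq /= !mul1r. Qed.
Fact scaleqDr : right_distributive scaleq +%R.
Proof. by move=> c x y; congr Quat; exact: mulrDr. Qed.
Fact scaleqDl x : {morph scaleq^~ x : c d / c + d}.
Proof. by move=> c d; congr Quat; exact: mulrDl. Qed.

HB.instance Definition _ := GRing.Zmodule_isLmodule.Build K (quat K)
  scaleqA scale1q scaleqDr scaleqDl.

Fact scaleqAl (c : K) x y : c *: (x * y) = (c *: x) * y.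
Proof.
by rewrite /GRing.scale /GRing.mul /= /mulq /scaleq /=; congr Quat; ring.
Qed.
HB.instance Definition _ := GRing.Lmodule_isLalgebra.Build K (quat K) scaleqAl.

Fact scaleqAr (c : K) x y : c *: (x * y) = x * (c *: y).
Proof.
by rewrite /GRing.scale /GRing.mul /= /mulq /scaleq /=; congr Quat; ring.
Qed.
HB.instance Definition _ := GRing.Lalgebra_isAlgebra.Build K (quat K) scaleqAr.

Definition qi : quat K := Quat 0 1 0 0.
Definition qj : quat K := Quat 0 0 1 0.
Definition qk : quat K := Quat 0 0 0 1.

Lemma qi_sqr : qi ^+ 2 = -1.
Proof. by congr Quat; rewrite /=; ring. Qed.
Lemma qj_sqr : qj ^+ 2 = -1.
Proof. by congr Quat; rewrite /=; ring. Qed.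
Lemma qk_sqr : qk ^+ 2 = -1.
Proof. by congr Quat; rewrite /=; ring. Qed.
Lemma qijk : qi * qj * qk = -1.
Proof. by congr Quat; rewrite /=; ring. Qed.

Lemma quatE (a b c d : K) :
  Quat a b c d = a%:A + b *: qi + c *: qj + d *: qk.
Proof. by congr Quat; rewrite /=; ring. Qed.

End QuatAlgebra.

Arguments qi {K}.
Arguments qj {K}.
Arguments qk {K}.

Definition quat_map (K L : Type) (f : K -> L) (x : quat K) : quat L :=
  Quat (f (q0 x)) (f (q1 x)) (f (q2 x)) (f (q3 x)).

Section Horadam.
Variable R : realType.
Implicit Types a b p q : R.

Fixpoint horadam a b p q (n : nat) : R :=
  match n with
  | 0 => a
  | m.+1 => if m is l.+1 then p * horadam a b p q m + q * horadam a b p q l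
            else b
  end.

Definition horadam_quat a b p q (n : nat) : quat R :=
  (horadam a b p q n)%:A + horadam a b p q n.+1 *: qi
  + horadam a b p q n.+2 *: qj + horadam a b p q n.+3 *: qk.

(* p ^+ 2 + 4 * q may be negative, so its square root is taken in R[i]. *)
Definition sqrt_disc p q : R[i] := sqrtC (p ^+ 2 + 4 * q)%:C.
Definition alpha p q : R[i] := (p%:C + sqrt_disc p q) / 2.
Definition beta p q : R[i] := (p%:C - sqrt_disc p q) / 2.

(* underlined x, for x = alpha or beta *)
Definition underline (x : R[i]) : quat R[i] :=
  1 + x *: qi + x ^+ 2 *: qj + x ^+ 3 *: qk.

(* The index is an integer because T_(-1) occurs; [_ ^ m] is the integer power
   of R[i], in which 0^-1 = 0 by convention. *)
Definition binetT p q (m : int) : R[i] :=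
  (sqrt_disc p q)^-1 *
  (((p%:C + sqrt_disc p q) / 2) ^ m - ((p%:C - sqrt_disc p q) / 2) ^ m).

(* The quaternion sequence attached to (T_m), in the same way as
   [horadam_quat] is attached to (W_n). *)
Definition binetT_quat p q (m : int) : quat R[i] :=
  (binetT p q m)%:A + binetT p q (m + 1) *: qi
  + binetT p q (m + 2) *: qj + binetT p q (m + 3) *: qk.

End Horadam.

(* Main.v *)
Require Import Defs.
From mathcomp Require Import all_boot all_order all_algebra.
From mathcomp Require Import ring reals complex.

Import Order.TTheory GRing.Theory Num.Theory.
Local Open Scope ring_scope.
Local Open Scope complex_scope.

(** The quaternion identities hold coordinate by coordinate, so they reduce to
    the scalar Binet formula [(x - y) W_n = (b - a y) x^n - (b - a x) y^n] for
    the roots [x], [y] of [X^2 - p X - q].  The second form follows by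
    regrouping the terms in [a], since [x y = - q] gives
    [y x^n - x y^n = - q (x^(n-1) - y^(n-1))]. *)

Lemma horadam_binet (R : realType) (a b p q : R) (x y : R[i]) (n : nat) :
  x + y = p%:C -> x * y = - q%:C ->
  (x - y) * (horadam a b p q n)%:C
    = (b%:C - a%:C * y) * x ^+ n - (b%:C - a%:C * x) * y ^+ n.
Proof.
move=> sum_xy prod_xy.
(* The recurrence has order two, so the induction carries two consecutive indices. *)
suff [] : (x - y) * (horadam a b p q n)%:C
    = (b%:C - a%:C * y) * x ^+ n - (b%:C - a%:C * x) * y ^+ n /\
  (x - y) * (horadam a b p q n.+1)%:C
    = (b%:C - a%:C * y) * x ^+ n.+1 - (b%:C - a%:C * x) * y ^+ n.+1 by [].
elim: n => [|n [IHn IHn1]]; first by split; rewrite /= ?expr0 ?expr1; ring.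
split=> //.
have -> : (horadam a b p q n.+2)%:C = p%:C * (horadam a b p q n.+1)%:C
    + q%:C * (horadam a b p q n)%:C by rewrite -!rmorphM -rmorphD.
(* With [p] and [q] expressed through the roots, what remains is a polynomial identity in [x], [y]
   and their [n]-th powers. *)
have -> : q%:C = - (x * y) by rewrite prod_xy opprK.
rewrite -sum_xy mulrDr mulrCA IHn1 mulrCA IHn !exprS; ring.
Qed.

(** At [n = 0] the factor [x ^ (-1)] is a true inverse only for nonzero [x], hence the side
    condition. *)
Lemma mul_exprz_pred (F : fieldType) (x y : F) (n : nat) :
  (0 < n)%N || (x * y != 0) -> x * y * x ^ (n%:Z - 1) = y * x ^+ n.
Proof.
case: n => [|n] /= xy_neq0.
  move: xy_neq0; rewrite mulf_eq0 negb_or => /andP[x_neq0 _].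
  by rewrite sub0r exprN1 expr0 mulrAC mulfV // mul1r mulr1.
by rewrite -addn1 PoszD addrK -exprnP addn1 exprS mulrAC mulrC.
Qed.

Section Roots.
Variables (R : realType) (p q : R).

Lemma alpha_add_beta : alpha p q + beta p q = p%:C.
Proof. by rewrite /alpha /beta; field. Qed.

Lemma alpha_sub_beta : alpha p q - beta p q = sqrt_disc p q.
Proof. by rewrite /alpha /beta; field. Qed.

Lemma alpha_mul_beta : alpha p q * beta p q = - q%:C.
Proof.
have sqr_s : sqrt_disc p q ^+ 2 = p%:C ^+ 2 + 4 * q%:C.
  by rewrite sqrtCK rmorphD rmorphXn rmorphM /= rmorph_nat.
have -> : alpha p q * beta p q = (p%:C ^+ 2 - sqrt_disc p q ^+ 2) / 4.
  by rewrite /alpha /beta; field.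
by rewrite sqr_s; field.
Qed.

Lemma sqrt_disc_neq0 : p ^+ 2 + 4 * q != 0 -> sqrt_disc p q != 0.
Proof. by rewrite sqrtC_eq0 fmorph_eq0. Qed.

End Roots.

(** The case [n = 0], [q = 0] is excluded because there the right-hand side is 0, while
    [W_0 = a]. *)
Lemma horadam_binetT (R : realType) (a b p q : R) (n : nat) :
  p ^+ 2 + 4 * q != 0 -> (0 < n)%N || (q != 0) ->
  (horadam a b p q n)%:C
    = b%:C * binetT p q n%:Z + (a * q)%:C * binetT p q (n%:Z - 1).
Proof.
move=> /sqrt_disc_neq0 s_neq0 n_q.
have prod := alpha_mul_beta _ p q.
have n_prod : (0 < n)%N || (alpha p q * beta p q != 0).
  by rewrite prod oppr_eq0 fmorph_eq0.
have n_prod' : (0 < n)%N || (beta p q * alpha p q != 0) by rewrite mulrC.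
(* Multiplying by the root of the discriminant, which is the difference of the roots, clears the
   denominators in [binetT]. *)
apply: (mulfI s_neq0); rewrite -{1}alpha_sub_beta.
rewrite (horadam_binet _ _ _ _ _ _ _ _ (alpha_add_beta _ p q) prod).
rewrite /binetT -/(alpha p q) -/(beta p q) -!exprnP mulrDr.
rewrite (mulrCA _ b%:C) (mulrCA _ (a * q)%:C) !mulVKf // rmorphM /=.
have -> : q%:C = - (alpha p q * beta p q) by rewrite prod opprK.
rewrite -[_ * - _ * _]mulrA mulNr [_ * beta p q * (_ - _)]mulrBr.
rewrite mul_exprz_pred //.
rewrite [alpha p q * beta p q]mulrC mul_exprz_pred //; ring.
Qed.

Theorem theorem3p1 (R : realType) (a b p q : R) (n : nat)
    (disc_neq0 : p ^+ 2 + 4 * q != 0) :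
  let al := alpha p q in
  let be := beta p q in
  let A := b%:C - a%:C * be in
  let B := b%:C - a%:C * al in
  let Q := quat_map (real_complex R) (horadam_quat a b p q n) in
  Q = (al - be)^-1 *:
        (A *: underline al * (al ^+ n)%:A - B *: underline be * (be ^+ n)%:A)
  /\ ((0 < n)%N || (q != 0) ->
      Q = b%:C *: binetT_quat p q n%:Z
          + (a * q)%:C *: binetT_quat p q (n%:Z - 1)).
Proof.
move=> al be A B Q.
have QE : Q = Quat (horadam a b p q n)%:C (horadam a b p q n.+1)%:C
    (horadam a b p q n.+2)%:C (horadam a b p q n.+3)%:C.
  by rewrite /Q /horadam_quat -quatE.
have underlineE x : underline x = Quat 1 x (x ^+ 2) (x ^+ 3).
  by rewrite quatE scale1r.
split=> [|n_q]; rewrite QE.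
  have s_neq0 : al - be != 0 by rewrite alpha_sub_beta sqrt_disc_neq0.
  have WE m : (horadam a b p q m)%:C
      = (al - be)^-1 * (A * al ^+ m - B * be ^+ m).
    rewrite -(horadam_binet _ _ _ _ _ _ _ _ (alpha_add_beta _ p q)
      (alpha_mul_beta _ p q)).
    by rewrite mulKf.
  (* The powers [al ^+ n] and [be ^+ n] are central scalars; in coordinate [m] they merge with the
     entry [x ^+ m] of [underline x] into the Binet formula at [n + m]. *)
  rewrite -!scalerAl -!scalerAr !mulr1 !underlineE !WE.
  by congr Quat; rewrite /= ?exprS; ring.
(* The side condition at [n] implies the one at [n + k]. *)
have WE k : (horadam a b p q (n + k))%:C = b%:C * binetT p q (n%:Z + k%:Z)
    + (a * q)%:C * binetT p q (n%:Z - 1 + k%:Z).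
  by rewrite addrAC -PoszD horadam_binetT // addn_gt0 orbAC n_q.
(* Writing the first index as [n + 0] gives all four coordinates the shape that [WE] expects. *)
rewrite /binetT_quat -!quatE -[X in Quat (horadam _ _ _ _ X)%:C]addn0.
by rewrite -(addn3 n) -(addn2 n) -(addn1 n) !WE !addr0.
Qed.
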